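(* Fix the gap shape (so that calibrated expected utility $U_C$ depends on $(\lambda,q)$ only through $R=3\lambda q$), and let the cost of blindness be $$\Delta_B=U_C-\bar U_B=\mathbb{E}\!\left[\left(\frac{\sigma^2(x)}{q}-1\right)_+\right],$$ viewed as a function $\Delta_B(R)$ of $R$. Then $\Delta_B(R)>0$ for all $R>0$ and $\Delta_B(R)$ is strictly decreasing in $R$ with $$\Delta_B'(R)=-\frac{1}{R^2}\,\mathbb{E}\!\left[3\lambda\sigma^2(x)\,\mathbf{1}\{3\lambda\sigma^2(x)>R\}\right]<0.$$
   Context: Knowledge points of intensity $\lambda>0$ on a line split the task space into gaps; $X$ denotes the gap length between adjacent knowledge points. Fixing the gap shape means that $X=Y/\lambda$ with $Y$ independent of $\lambda$: changing $\lambda$ changes the intensity but not the shape of the gap-length distribution. A task $x$ is drawn uniformly, so the gap containing it has the length-biased length $X^*$, with $\Pr(X^*\in A)=\mathbb{E}[X\mathbf{1}\{X\in A\}]/\mathbb{E}[X]$. The local posterior variance at a task $x$ between consecutive knowledge points $x_i<x<x_{i+1}$ is the Brownian-bridge variance $\sigma^2(x)=(x-x_i)(x_{i+1}-x)/(x_{i+1}-x_i)$, i.e. $\sigma^2(x)=X^*u(1-u)$ with $u\sim\mathrm{Uniform}(0,1)$ the relative location in the gap, independent of $X^*$. With stakes parameter $q>0$ and $(a)_+=\max\{a,0\}$, $U_C=\mathbb{E}[(1-\sigma^2(x)/q)_+]$ is calibrated expected utility and $\bar U_B=\mathbb{E}[1-\sigma^2(x)/q]$ is expected utility from blindly relying on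 the AI on all tasks. Under a fixed gap shape the law of $3\lambda\sigma^2(x)$ does not depend on $\lambda$. (The baseline gap shape is the Poisson one, $X\sim\mathrm{Exponential}(\lambda)$, for which $\bar U_B=1-1/R$.)
   Formalization: Positivity, strict decrease and Δ_B'<0 are stated only for gap shapes with unbounded gaps (Pr(Y>t)>0 for all t): with Y=1, Δ_B(R)=0 for R≥3/4. E[Y]=1 (λ is the intensity) and E[Y²]<∞ are assumed, so Δ_B is finite; the derivative formula holds for all such shapes. *)

(* Defs.v *)
From HB Require Import structures.
From mathcomp Require Import all_boot all_order all_algebra.
From mathcomp Require Import all_classical all_reals all_analysis.

Set Implicit Arguments.
Unset Strict Implicit.
Unset Printing Implicit Defensive.

Import Order.TTheory GRing.Theory Num.Theory.
Import numFieldNormedType.Exports.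

Local Open Scope classical_set_scope.
Local Open Scope ring_scope.

Definition independent_RVs (d : measure_display) (T : measurableType d)
    (R : realType) (P : probability T R) (X Z : {RV P >-> R}) : Prop :=
  forall A B : set R, measurable A -> measurable B ->
    (P (X @^-1` A `&` Z @^-1` B) = P (X @^-1` A) * P (Z @^-1` B))%E.
Arguments independent_RVs {d T R} P X Z.

Definition gap (S : Type) (R : realType) (Y : S -> R) (lambda : R) : S -> R :=
  fun s => Y s / lambda.

(* Gaps are positive and the second moment, hence the mean posterior variance
   E[X^2] / (6 E[X]), is finite. The normalization E[Y] = 1 says that lambda is
   the intensity: the mean gap between adjacent points is 1 / lambda. *)
Definition gap_shape (d : measure_display) (S : measurableType d)
    (R : realType) (Q : probability S R) (Y : {RV Q >-> R}) : Prop :=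
  [/\ {ae Q, forall s, 0 < Y s},
      ('E_Q[Y] = 1)%E &
      ('E_Q[fun s => (Y s ^+ 2)%R] < +oo)%E].
Arguments gap_shape {d S R} Q Y.

(* If Y <= b almost surely then 3 * lambda * sigma^2 <= 3 * b / 4, so the cost of
   blindness vanishes for large R: its positivity for all R requires unbounded
   gaps. The Poisson shape has them, with Q (Y > t) = exp (- t) for t >= 0. *)
Definition unbounded_gaps (d : measure_display) (S : measurableType d)
    (R : realType) (Q : probability S R) (Y : {RV Q >-> R}) : Prop :=
  forall t : R, (0 < Q [set s | (t < Y s)%R])%E.
Arguments unbounded_gaps {d S R} Q Y.

Definition length_biased (dS dT : measure_display) (S : measurableType dS)
    (T : measurableType dT) (R : realType) (Q : probability S R) (X : S -> R)
    (P : probability T R) (Xs : {RV P >-> R}) : Prop :=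
  forall A : set R, measurable A ->
    distribution P Xs A =
      ('E_Q[fun s => (X s * \1_(X @^-1` A) s)%R] / 'E_Q[X])%E.
Arguments length_biased {dS dT S T R} Q X P Xs.

(* Xs lambda is the length of the gap containing a uniformly drawn task when
   the intensity is lambda, and U is the relative location of the task in it. *)
Definition task_model (dS dT : measure_display) (S : measurableType dS)
    (T : measurableType dT) (R : realType) (Q : probability S R)
    (Y : {RV Q >-> R}) (P : probability T R)
    (Xs : R -> {RV P >-> R}) (U : {RV P >-> R}) : Prop :=
  [/\ forall lambda : R, 0 < lambda -> length_biased Q (gap Y lambda) P (Xs lambda),
      forall A : set R, measurable A ->
        distribution P U A = uniform_prob (@ltr01 R) A &
      forall lambda : R, 0 < lambda -> independent_RVs P (Xs lambda) U].
Arguments task_model {dS dT S T R} Q Y P Xs U.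

Definition bridge_var (R : realType) (a b x : R) : R :=
  (x - a) * (b - x) / (b - a).

(* By translation invariance the left end of the gap is put at 0, so that the
   right end is the gap length L and the task is at L * u. *)
Definition sigma2 (T : Type) (R : realType) (L U : T -> R) : T -> R :=
  fun w => bridge_var 0 (L w) (L w * U w).

Lemma sigma2E (T : Type) (R : realType) (L U : T -> R) (w : T) :
  sigma2 L U w = L w * U w * (1 - U w).
Proof.
rewrite /sigma2 /bridge_var !subr0.
have [->|L0] := eqVneq (L w) 0; first by rewrite !mul0r.
by rewrite -[X in X - L w * U w]mulr1 -mulrBr [L w * (1 - U w)]mulrC mulrA mulfK.
Qed.

Definition calibrated_utility (d : measure_display) (T : measurableType d)
    (R : realType) (P : probability T R) (s2 : T -> R) (q : R) : \bar R :=
  ('E_P[fun w => Num.max (1 - s2 w / q)%R 0%R])%E.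

Definition blind_utility (d : measure_display) (T : measurableType d)
    (R : realType) (P : probability T R) (s2 : T -> R) (q : R) : \bar R :=
  ('E_P[fun w => (1 - s2 w / q)%R])%E.

(* Main.v *)
Require Import Defs.
From HB Require Import structures.
From mathcomp Require Import all_boot all_order all_algebra.
From mathcomp Require Import all_classical all_reals all_analysis.
From mathcomp Require Import measurable_realfun ring lra.

Import Order.TTheory GRing.Theory Num.Theory.
Import numFieldNormedType.Exports.

Local Open Scope classical_set_scope.
Local Open Scope ring_scope.

(* By length-biasing, lambda * Xs lambda has density y against the law of Y,
   whatever lambda, and it is independent of U, so the law of
   Z = 3 lambda sigma^2 does not depend on lambda. In the variable t = 1 / R the
   cost of blindness is the convex function h t = E[(t Z - 1)_+], which has the
   subgradient E[Z 1{t Z > 1}]. Since U has no atoms, neither has Z away from 0,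
   and dominated convergence of the difference quotients shows that this
   subgradient is the derivative of h. The chain rule then gives
   h (1 / R)' = - E[Z 1{Z > R}] / R^2, and unbounded gaps give P (Z > R) > 0,
   from which the strict monotonicity and the positivity follow. *)

(** * The hinge and the derivative of its expectation *)

Definition hinge {R : realType} (t z : R) : R := Num.max (t * z - 1) 0.
(** At the kink [t * z = 1] every value between 0 and [z] is a subgradient in [t]; taking 0 there
    makes the strict indicator of Z > R appear at t = 1 / R. *)
Definition hinge_slope {R : realType} (t z : R) : R := if 1 < t * z then z else 0.

Lemma hinge_ge0 (R : realType) (t z : R) : 0 <= hinge t z.
Proof. by rewrite /hinge le_max lexx orbT. Qed.

Lemma measurable_hinge {R : realType} (t : R) : measurable_fun setT (hinge t).
Proof.
by apply: measurable_maxr => //; exact: measurable_funB.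
Qed.

Lemma measurable_hinge_slope {R : realType} (t : R) :
  measurable_fun setT (hinge_slope t).
Proof.
apply: measurable_fun_if => //.
by apply: measurable_fun_ltr => //; exact: measurable_funM.
Qed.

(** The hinge is a maximum of two affine functions of [t], and the chosen slope is that of one
    active at [s]. *)
Lemma hinge_subgradient {R : realType} (s t z : R) :
  (t - s) * hinge_slope s z <= hinge t z - hinge s z.
Proof.
rewrite /hinge_slope /hinge /Num.max.
case: ifPn => h1; case: ifPn => h2; case: ifPn => h3; lra.
Qed.

(** Truncation at 0 is 1-Lipschitz. This gives the dominating function |Z| for the difference
    quotients and, from [s = 0] where the hinge vanishes, its integrability. *)
Lemma hinge_lipschitz {R : realType} (s t z : R) :
  `|hinge t z - hinge s z| <= `|t - s| * `|z|.
Proof.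
rewrite -normrM ler_norml.
have := ler_norm ((t - s) * z); have := ler_norm (- ((t - s) * z)); rewrite normrN.
by rewrite /hinge /Num.max; case: ifPn => h2; case: ifPn => h3; lra.
Qed.

Section hinge_expectation.
Context {d : measure_display} {T : measurableType d} {R : realType}.
Variables (P : probability T R) (Z : T -> R).
Hypothesis mZ : measurable_fun setT Z.
Hypothesis iZ : P.-integrable setT (EFin \o Z).

Let meas (f : R -> R) :
  measurable_fun setT f -> measurable_fun setT (EFin \o (f \o Z)).
Proof. by move=> mf; apply/measurable_EFinP; exact: measurableT_comp. Qed.

Lemma integrable_hinge t : P.-integrable setT (EFin \o (hinge t \o Z)).
Proof.
apply: (@le_integrable _ _ _ _ _ measurableT _ (fun w => t%:E * (Z w)%:E)%E).
- by apply: meas; exact: measurable_hinge.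
- move=> w _ /=; rewrite lee_fin.
  rewrite normrM; have := hinge_lipschitz 0 t (Z w).
  by rewrite /hinge mul0r (_ : Num.max (0 - 1) 0 = 0) ?subr0 // max_r; lra.
- exact: integrableZl.
Qed.

Lemma integrable_hinge_slope t :
  P.-integrable setT (EFin \o (hinge_slope t \o Z)).
Proof.
apply: (@le_integrable _ _ _ _ _ measurableT _ (EFin \o Z)) => //.
- by apply: meas; exact: measurable_hinge_slope.
- move=> w _ /=; rewrite lee_fin /hinge_slope.
  by case: ifPn => // _; rewrite normr0.
Qed.

Definition mean_hinge t := \int[P]_w hinge t (Z w).
Definition mean_slope t := \int[P]_w hinge_slope t (Z w).

Lemma mean_hingeE t : (mean_hinge t)%:E = (\int[P]_w (hinge t (Z w))%:E)%E.
Proof. by rewrite /mean_hinge /Rintegral fineK// integrable_fin_num// integrable_hinge. Qed.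

Lemma mean_slopeE t : (mean_slope t)%:E = (\int[P]_w (hinge_slope t (Z w))%:E)%E.
Proof.
by rewrite /mean_slope /Rintegral fineK// integrable_fin_num// integrable_hinge_slope.
Qed.

Lemma mean_hinge_subgradient s t :
  (t - s) * mean_slope s <= mean_hinge t - mean_hinge s.
Proof.
rewrite /mean_slope /mean_hinge -RintegralZl//; last exact: integrable_hinge_slope.
rewrite -RintegralB//; [|exact: integrable_hinge..].
apply: le_Rintegral => //.
- exact: (integrableZl measurableT (t - s) (integrable_hinge_slope s)).
- exact: (integrableB measurableT (integrable_hinge _) (integrable_hinge _)).
- by move=> w _; exact: hinge_subgradient.
Qed.

(** Off the kink, [(u n + t) * z] ends up on the same side of 1 as [t * z]; the hinge is affine
    there, so the quotient is eventually constant. *)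
Let hinge_quotient_cvg t z (u : nat -> R) : t * z != 1 ->
  (forall n, u n != 0) -> u n @[n --> \oo] --> 0 ->
  (u n)^-1 * (hinge (u n + t) z - hinge t z) @[n --> \oo] --> hinge_slope t z.
Proof.
move=> tz u0 ucv; apply: cvg_near_cst.
have cv : (u n + t) * z @[n --> \oo] --> t * z.
  rewrite -{2}(add0r t); apply: cvgM; last exact: cvg_cst.
  by apply: cvgD => //; exact: cvg_cst.
case: (ltgtP (t * z) 1) tz => // tz _; rewrite /hinge_slope.
  near=> n; have un : (u n + t) * z < 1 by near: n; exact: cvgr_lt cv _ tz.
  rewrite ltNge (ltW tz)/= /hinge !max_r ?subrr ?mulr0//; lra.
near=> n; have un : (u n + t) * z > 1 by near: n; exact: cvgr_gt cv _ tz.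
rewrite tz /hinge !max_l; [|lra..].
by rewrite (_ : _ - _ - _ = u n * z) ?mulKf//; ring.
Unshelve. all: by end_near. Qed.

Lemma mean_hinge_quotient_cvg t : P [set w | t * Z w = 1] = 0%E ->
  h^-1 *: (mean_hinge (h + t) - mean_hinge t) @[h --> 0^'] --> mean_slope t.
Proof.
move=> Pt0; apply/cvgr_dnbhsP => u [u0 ucv].
have iq n : P.-integrable setT
    (fun w => ((u n)^-1 * (hinge (u n + t) (Z w) - hinge t (Z w)))%:E).
  apply: (integrableZl measurableT (u n)^-1
    (integrableB measurableT (integrable_hinge _) (integrable_hinge _))).
rewrite (_ : (fun n => _) = fun n =>
    \int[P]_w ((u n)^-1 * (hinge (u n + t) (Z w) - hinge t (Z w)))); last first.
  apply/funext => n; rewrite RintegralZl//; last first.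
    exact: (integrableB measurableT (integrable_hinge _) (integrable_hinge _)).
  rewrite RintegralB//; exact: integrable_hinge.
apply: fine_cvg; rewrite -/(mean_slope t) mean_slopeE.
have mE : measurable [set w | t * Z w = 1].
  rewrite -[X in measurable X]setTI.
  exact: (measurable_funM (measurable_cst t) mZ) measurableT _ (measurable_set1 1).
have [] // := @dominated_convergence _ _ _ P setT measurableT
  (fun n w => ((u n)^-1 * (hinge (u n + t) (Z w) - hinge t (Z w)))%:E)
  (fun w => (hinge_slope t (Z w))%:E) (fun w => `|(Z w)%:E|%E).
- by move=> n; exact: measurable_int (iq n).
- exact: (meas _ (measurable_hinge_slope t)).
(* Pointwise convergence can fail only on the kink, null by hypothesis. *)
- exists [set w | t * Z w = 1]; split => // w /= h.
  apply/eqP; apply: contrapT => /negP tz; apply: h => _.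
  by apply: cvg_EFin; [exact: nearW|exact: hinge_quotient_cvg].
- exact: integrable_abse.
- apply: aeW => w n _; rewrite lee_fin normrM normfV ler_pdivrMl ?normr_gt0//.
  by rewrite (le_trans (hinge_lipschitz _ _ _))// addrK.
Qed.

Lemma is_derive_mean_hinge t : P [set w | t * Z w = 1] = 0%E ->
  is_derive t 1 mean_hinge (mean_slope t).
Proof.
move=> /mean_hinge_quotient_cvg cv.
have cv' : h^-1 *: (mean_hinge (h *: 1 + t) - mean_hinge t) @[h --> 0^']
    --> mean_slope t.
  by move: cv; under eq_fun do rewrite -[X in mean_hinge (X + _)]mulr1.
by apply: DeriveDef; [apply/cvg_ex; exists (mean_slope t)|exact/cvg_lim].
Qed.

End hinge_expectation.

(** * Integration against the image of a measure with density *)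

Section integral_density.
Local Open Scope ereal_scope.
Context {d d' : measure_display} {S : measurableType d} {T : measurableType d'}
  {R : realType} {mu : {measure set S -> \bar R}} {nu : {measure set T -> \bar R}}
  {phi : S -> T} {D : S -> R}.
Hypothesis mphi : measurable_fun setT phi.
Hypothesis mD : measurable_fun setT D.
Hypothesis D0 : forall s, (0 <= D s)%R.
Hypothesis nuE : forall A, measurable A ->
  nu A = \int[mu]_s (\1_A (phi s) * D s)%:E.

Import HBNNSimple.

(** A simple function is a finite combination of indicators of its level sets, and [nuE] settles
    each of them. *)
Let integral_density_nnsfun (f : {nnsfun T >-> R}) :
  \int[nu]_x (f x)%:E = \int[mu]_s (f (phi s) * D s)%:E.
Proof.
have mi r : measurable_fun setT (fun s => (r * \1_(f @^-1` [set r]) (phi s))%R).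
  by apply: measurable_funM => //; apply: measurableT_comp => //.
have i0 r s : (0 <= r * \1_(f @^-1` [set r]) (phi s))%R.
  by have := nnfun_muleindic_ge0 f r (phi s); rewrite -EFinM lee_fin.
under eq_integral do rewrite fimfunE -fsumEFin//.
rewrite ge0_integral_fsum//; last 2 first.
  - by move=> r; exact/measurable_EFinP/measurable_funM.
  - by move=> r x _; rewrite EFinM nnfun_muleindic_ge0.
under [RHS]eq_integral.
  move=> s _; rewrite fimfunE EFinM -fsumEFin// ge0_mule_fsuml; last first.
    by move=> r; rewrite lee_fin.
  over.
rewrite [RHS]ge0_integral_fsum//; last 2 first.
  - by move=> r; apply: emeasurable_funM; exact/measurable_EFinP.
  - by move=> r s _; rewrite mule_ge0 ?lee_fin.
apply: eq_fsbigr => r; rewrite inE => -[x _ <-].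
have mf : measurable (f @^-1` [set f x]) by [].
under eq_integral do rewrite EFinM.
rewrite ge0_integralZl ?lee_fin//; last exact/measurable_EFinP.
rewrite integral_indic// setIT nuE// -ge0_integralZl; last 4 first.
  - exact: measurableT.
  - by apply/measurable_EFinP/measurable_funM => //; apply: measurableT_comp.
  - by move=> s _; rewrite lee_fin mulr_ge0.
  - by rewrite lee_fin.
by apply: eq_integral => s _; rewrite -!EFinM mulrA.
Qed.

(** Simple functions increase to [f], and monotone convergence applies on both sides because [D] is
    nonnegative. Length-biasing is the case where [phi] is [Y] and [D] is its absolute value. *)
Lemma ge0_integral_density (f : T -> R) :
  measurable_fun setT f -> (forall x, (0 <= f x)%R) ->
  \int[nu]_x (f x)%:E = \int[mu]_s (f (phi s) * D s)%:E.
Proof.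
move=> mf f0.
have mEf : measurable_fun setT (EFin \o f) by exact/measurable_EFinP.
pose f_ := nnsfun_approx measurableT mEf.
have f_cvg x : (f_ n x)%:E @[n --> \oo] --> (f x)%:E.
  by apply: (cvg_nnsfun_approx measurableT mEf) => // ? _; rewrite lee_fin.
transitivity (limn (fun n => \int[nu]_x (f_ n x)%:E)).
  rewrite -monotone_convergence//=.
  - by apply: eq_integral => x _; exact/esym/cvg_lim.
  - by move=> n; exact/measurable_EFinP.
  - by move=> n x _; rewrite lee_fin.
  - by move=> x _ m n mn; rewrite lee_fin; exact/lefP/nd_nnsfun_approx.
transitivity (limn (fun n => \int[mu]_s (f_ n (phi s) * D s)%:E)).
  by congr (limn _); apply/funext => n; exact: integral_density_nnsfun.
rewrite -monotone_convergence//=.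
- apply: eq_integral => s _; apply/cvg_lim => //=.
  under eq_fun do rewrite EFinM.
  by rewrite EFinM; apply: cvgeZr.
- move=> n; apply/measurable_EFinP/measurable_funM => //.
  exact: measurableT_comp.
- by move=> n s _; rewrite lee_fin mulr_ge0.
- move=> s _ m n mn; rewrite lee_fin ler_wpM2r//.
  exact/lefP/nd_nnsfun_approx.
Qed.

End integral_density.

(** * Joint law of independent variables *)

Section joint_law.
Local Open Scope ereal_scope.
Context {d d1 d2 : measure_display} {T : measurableType d}
  {T1 : measurableType d1} {T2 : measurableType d2} {R : realType}
  {P : probability T R} {X : T -> T1} {U : T -> T2}
  {m1 : probability T1 R} {m2 : probability T2 R}.
Hypotheses (mX : measurable_fun setT X) (mU : measurable_fun setT U).
Hypothesis XU : forall A B, measurable A -> measurable B ->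
  P (X @^-1` A `&` U @^-1` B) = m1 A * m2 B.

Let XUmixin := isMeasurableFun.Build _ _ _ _ _ (measurable_fun_pair mX mU).
Let XUpack : {mfun T >-> (T1 * T2)%type} := HB.pack (fun w => (X w, U w)) XUmixin.

(** By [XU] both measures agree on measurable rectangles, which determine the product measure. *)
Lemma independent_joint_law (C : set (T1 * T2)) : measurable C ->
  P [set w | C (X w, U w)] = (m1 \x m2) C.
Proof.
move=> mC; apply/esym.
exact: (@product_measure_unique _ _ _ _ _ m1 m2 (distribution P XUpack)).
Qed.

Lemma ge0_integral_independent (f : T1 * T2 -> R) :
  measurable_fun setT f -> (forall x, (0 <= f x)%R) ->
  \int[P]_w (f (X w, U w))%:E = \int[m1 \x m2]_x (f x)%:E.
Proof.
move=> mf f0; have mEf : measurable_fun setT (EFin \o f) by exact/measurable_EFinP.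
rewrite -[LHS](@ge0_integral_distribution _ _ _ _ _ P XUpack (EFin \o f))//; last first.
apply: eq_measure_integral => C mC _; exact: independent_joint_law.
Qed.

End joint_law.

(** * Null and non-null sets of the uniform law *)

Section uniform_law.
Context {R : realType}.

Lemma uniform_prob_null (A : set R) : measurable A ->
  countable A -> uniform_prob (@ltr01 R) A = 0%E.
Proof.
move=> mA cA; have := @dominates_uniform_prob R 0 1 ltr01.
move/null_content_dominatesP; apply => //; exact: countable_lebesgue_measure0.
Qed.

Lemma uniform_prob_setC_itv01 :
  uniform_prob (@ltr01 R) (~` `[0, 1]%classic) = 0%E.
Proof. by rewrite /uniform_prob integral_uniform_pdf setICl integral_set0. Qed.

Lemma uniform_prob_itv_gt0 (a b : R) : 0 <= a -> a < b -> b <= 1 ->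
  (0 < uniform_prob (@ltr01 R) `[a, b]%classic)%E.
Proof.
move=> a0 ab b1; rewrite /uniform_prob (eq_integral (cst 1%E)).
  by rewrite integral_cst//= mul1e lebesgue_measure_itv/= lte_fin ab lte_fin subr_gt0.
move=> x; rewrite inE/= in_itv/= => /andP[ax xb].
by rewrite /uniform_pdf (le_trans a0 ax) (le_trans xb b1) subr0 invr1.
Qed.

End uniform_law.

(** * Length-biased gaps and the intensity *)

Lemma measurable_preimage_scale {R : realType} (lambda : R) (A : set R) :
  measurable A -> measurable [set x : R | A (lambda * x)].
Proof.
move=> mA; rewrite -[X in measurable X]setTI.
exact: (measurable_funM (measurable_cst lambda) (@measurable_id _ _ setT)).
Qed.

Section gap_shape.
Context {R : realType} {dS : measure_display} {S : measurableType dS}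
  {Q : probability S R} {Y : {RV Q >-> R}}.
Hypothesis Yshape : gap_shape Q Y.

(** Gaps are positive only almost surely; with the absolute value of [Y] as density, nonnegativity
    holds everywhere, as [ge0_integral_density] requires. *)
Let Y_abs : {ae Q, forall s, `|Y s| = Y s}.
Proof. by have [Y0 _ _] := Yshape; apply: filterS Y0 => s; exact: gtr0_norm. Qed.

Lemma integrable_gap_shape : Q.-integrable setT (EFin \o Y).
Proof.
have [_ EY _] := Yshape; apply/integrableP; split; first exact/measurable_EFinP.
rewrite (ae_eq_integral (EFin \o Y)) //; last 3 first.
- by apply: measurableT_comp => //; exact/measurable_EFinP.
- exact/measurable_EFinP.
- by apply: filterS Y_abs => s /= Ys _; rewrite Ys.
by move: EY; rewrite unlock => ->; rewrite ltry.
Qed.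

Lemma integrable_shape_indic (A : set R) : measurable A ->
  Q.-integrable setT (fun s => (\1_A (Y s) * `|Y s|)%:E).
Proof.
move=> mA; apply: (le_integrable _ _ _ integrable_gap_shape) => //.
- apply/measurable_EFinP/measurable_funM; apply: measurableT_comp => //.
- move=> s _ /=; rewrite lee_fin normrM normr_id ger0_norm ?indicE//.
  by rewrite ler_piMl// lern1 leq_b1.
Qed.

(** The factor 1 / lambda enters both the weight X = Y / lambda and the mean E[X] = 1 / lambda, and
    cancels; what remains is free of [lambda]. *)
Lemma length_biased_gap {dT : measure_display} {T : measurableType dT}
    {P : probability T R} {Xs : {RV P >-> R}} {lambda : R} :
    0 < lambda -> length_biased Q (gap Y lambda) P Xs ->
  forall A : set R, measurable A ->
    P [set w | A (lambda * Xs w)] = (\int[Q]_s (\1_A (Y s) * `|Y s|)%:E)%E.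
Proof.
move=> l0 lb A mA; pose A' := [set x : R | A (lambda * x)].
have mA' : measurable A' by exact: measurable_preimage_scale.
have [_ EY _] := Yshape.
rewrite -[LHS]/(distribution P Xs A') lb//.
have iY := integrable_gap_shape.
have -> : ('E_Q[gap Y lambda] = (lambda^-1)%:E)%E.
  rewrite -[gap Y lambda]/(lambda^-1 \o* Y) expectationZl ?EY ?mule1//.
  exact/Lfun1_integrable.
have iI := integrable_shape_indic A mA.
rewrite unlock (ae_eq_integral (fun s => (lambda^-1)%:E * (\1_A (Y s) * `|Y s|)%:E)%E)//.
- rewrite integralZl//.
  rewrite inver invr_eq0 gt_eqF// invrK -(fineK (integrable_fin_num measurableT iI)).
  by rewrite -!EFinM mulrC mulrA mulfV ?mul1r// gt_eqF.
- apply/measurable_EFinP/measurable_funM; first exact: measurable_funM.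
  apply: measurable_indic.
  rewrite -[_ @^-1` _]setTI.
  exact: (measurable_funM (measurable_funP Y) (measurable_cst lambda^-1)).
- exact: measurable_int (integrableZl measurableT _ iI).
- apply: filterS Y_abs => s Ys _.
  rewrite Ys -EFinM; congr EFin; rewrite /gap !indicE.
  have -> : (s \in (fun s => Y s / lambda) @^-1` A') = (Y s \in A).
    apply/idP/idP; rewrite !inE /A' /=; by rewrite mulrC divfK ?gt_eqF.
  ring.
Qed.

End gap_shape.

(* 3 * sigma^2 for a task at relative location p.2 in a gap of length p.1. *)
Definition scaled_bridge {R : realType} (p : R * R) : R :=
  3 * (p.1 * p.2 * (1 - p.2)).

Lemma measurable_scaled_bridge {R : realType} :
  measurable_fun setT (@scaled_bridge R).
Proof.
apply: measurable_funM => //; apply: measurable_funM.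
- exact: measurable_funM.
- exact: measurable_funB.
Qed.

Lemma measurable_superlevel {d : measure_display} {T : measurableType d}
    {R : realType} (f : T -> R) (r : R) :
  measurable_fun setT f -> measurable [set x | r < f x].
Proof.
move=> mf; rewrite (_ : [set x | r < f x] = setT `&` f @^-1` `]r, +oo[%classic).
  by apply: mf.
by apply/seteqP; split => x /=; rewrite in_itv/= andbT // => -[].
Qed.

(** * The law of 3 lambda sigma^2 *)

Section scaled_variance.
Context {R : realType}
  {dS : measure_display} {S : measurableType dS} {Q : probability S R}
  {Y : {RV Q >-> R}}
  {dT : measure_display} {T : measurableType dT} {P : probability T R}
  (Xs : R -> {RV P >-> R}) (U : {RV P >-> R}).
Hypotheses (Yshape : gap_shape Q Y) (model : task_model Q Y P Xs U).

Definition scaled_variance (lambda : R) (w : T) : R :=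
  3 * lambda * sigma2 (Xs lambda) U w.

Let scaled_varianceE (lambda : R) (w : T) :
  scaled_variance lambda w = scaled_bridge (lambda * Xs lambda w, U w).
Proof. by rewrite /scaled_variance sigma2E /scaled_bridge /=; ring. Qed.

Let mXs (lambda : R) : measurable_fun setT (fun w => lambda * Xs lambda w).
Proof. exact: measurable_funM. Qed.

Lemma measurable_scaled_variance (lambda : R) :
  measurable_fun setT (scaled_variance lambda).
Proof.
rewrite (_ : scaled_variance _ =
  fun w => scaled_bridge (lambda * Xs lambda w, U w)); last first.
  by apply/funext => w; exact: scaled_varianceE.
apply: measurableT_comp; first exact: measurable_scaled_bridge.
exact: measurable_fun_pair.
Qed.

(** The gap length at intensity 1 is the reference law, shared by [lambda * Xs lambda] for every
    positive [lambda]. *)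
Let m1 : probability _ R := distribution P (Xs 1).
Let m2 : probability _ R := distribution P U.

Let gap_law (lambda : R) (A : set R) : 0 < lambda -> measurable A ->
  P [set w | A (lambda * Xs lambda w)] = (\int[Q]_s (\1_A (Y s) * `|Y s|)%:E)%E.
Proof.
by move=> l0 mA; have [lb _ _] := model; exact: length_biased_gap (lb _ l0) A mA.
Qed.

Let m1E (A : set R) : measurable A ->
  m1 A = (\int[Q]_s (\1_A (Y s) * `|Y s|)%:E)%E.
Proof.
move=> mA; rewrite -(gap_law 1 A ltr01 mA) /m1 /distribution /pushforward.
by congr (P _); apply/seteqP; split => w /=; rewrite mul1r.
Qed.

(** Independence at intensity [lambda] is applied to the rescaled event; [gap_law] then makes the
    first factor independent of [lambda]. *)
Let gap_location_law (lambda : R) : 0 < lambda ->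
  forall A B : set R, measurable A -> measurable B ->
  (P ((fun w => (lambda * Xs lambda w)%R) @^-1` A `&` U @^-1` B) = m1 A * m2 B)%E.
Proof.
move=> l0 A B mA mB; have [_ _ ind] := model.
have mA' : measurable [set x : R | A (lambda * x)].
  exact: measurable_preimage_scale.
rewrite m1E// -(gap_law lambda)//.
exact: (ind _ l0 [set x : R | A (lambda * x)]).
Qed.

(** Both sides are the integral of [f \o scaled_bridge] against [m1 \x m2]. *)
Lemma scaled_variance_law (lambda : R) (f : R -> R) : 0 < lambda ->
  measurable_fun setT f -> (forall x, 0 <= f x) ->
  (\int[P]_w (f (scaled_variance lambda w))%:E =
   \int[P]_w (f (scaled_variance 1 w))%:E)%E.
Proof.
move=> l0 mf f0.
have law (l : R) : 0 < l ->
    (\int[P]_w (f (scaled_variance l w))%:E =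
     \int[m1 \x m2]_p (f (scaled_bridge p))%:E)%E.
  move=> lp; under eq_integral do rewrite scaled_varianceE.
  have mU : measurable_fun setT U by [].
  apply: (ge0_integral_independent (mXs l) mU
    (gap_location_law l lp) (f \o scaled_bridge)) => //.
    by apply: measurableT_comp => //; exact: measurable_scaled_bridge.
  by move=> p; exact: f0.
by rewrite !law.
Qed.

(** At intensity 1, u (1 - u) <= 1 on the unit interval bounds the variable by 3 |[Xs 1]|, and
    length-biasing turns the mean of |[Xs 1]| into E[Y^2], finite by [gap_shape]. *)
Lemma integrable_scaled_variance (lambda : R) : 0 < lambda ->
  P.-integrable setT (EFin \o scaled_variance lambda).
Proof.
move=> l0; apply/integrableP; split.
  by apply/measurable_EFinP; exact: measurable_scaled_variance.
rewrite (scaled_variance_law lambda (fun x => `|x|))//.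
have [_ lawU _] := model; have [_ _ EY2] := Yshape.
have U01 : {ae P, forall w, 0 <= U w <= 1}.
  exists (U @^-1` (~` `[0, 1]%classic)); split.
  - rewrite -[X in measurable X]setTI; apply: measurable_funP => //.
    exact: measurableC.
  - rewrite -[LHS]/(distribution P U (~` _)) lawU; last exact: measurableC.
    exact: uniform_prob_setC_itv01.
  - by move=> w /= h; rewrite in_itv/=.
apply: (@le_lt_trans _ _ (\int[P]_w (3 * `|Xs 1 w|)%:E)%E).
  apply: ae_ge0_le_integral => //.
  - by apply/measurable_EFinP/measurableT_comp => //; exact: measurable_scaled_variance.
  - by apply/measurable_EFinP/measurable_funM => //; apply: measurableT_comp.
  apply: filterS U01 => w /andP[u0 u1] _; rewrite lee_fin scaled_varianceE.
  rewrite /scaled_bridge/= mul1r !normrM ger0_norm// ler_wpM2l//.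
  rewrite -mulrA ler_piMr// (ger0_norm u0) ger0_norm ?subr_ge0//.
  by rewrite mulr_ile1// ?subr_ge0// gerBl.
under eq_integral do rewrite EFinM.
rewrite ge0_integralZl//; last exact/measurable_EFinP/measurableT_comp.
rewrite lte_mul_pinfty// -(@ge0_integral_distribution _ _ _ _ _ P (Xs 1) (fun x => `|x|%:E))//; last first.
  by apply/measurable_EFinP.
rewrite (ge0_integral_density (measurable_funP Y) _ _ m1E) //; last first.
  exact: measurableT_comp.
move: EY2; rewrite unlock; apply: le_lt_trans; rewrite le_eqVlt; apply/orP; left.
apply/eqP/eq_integral => s _; by rewrite -normrM -expr2 ger0_norm// sqr_ge0.
Qed.

(* Given the gap length, at most two locations give a prescribed nonzero value. *)
Lemma scaled_variance_atomless (r : R) : r != 0 ->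
  P [set w | scaled_variance 1 w = r] = 0%E.
Proof.
move=> r0.
have mC : measurable (scaled_bridge @^-1` [set r] : set (R * R)).
  by rewrite -[X in measurable X]setTI; apply: measurable_scaled_bridge.
have -> : [set w | scaled_variance 1 w = r] =
    [set w | (scaled_bridge @^-1` [set r]) (1 * Xs 1 w, U w)].
  by apply/seteqP; split => w /=; rewrite scaled_varianceE.
have mU : measurable_fun setT U by [].
rewrite (independent_joint_law (mXs 1) mU (gap_location_law 1 ltr01))//.
(* It suffices that, for each fixed gap length, the section of the level set is null for the uniform
   law. *)
rewrite /product_measure1; apply: integral0_eq => x _.
have [_ lawU _] := model.
rewrite -[LHS]/(distribution P U (xsection _ x)) lawU; last exact: measurable_xsection.
apply: uniform_prob_null; first exact: measurable_xsection.
set A := xsection _ _.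
have [->//|/set0P[a]] := eqVneq A set0.
rewrite /A /xsection/= inE /scaled_bridge/= => xa.
(* u (1 - u) is symmetric about 1/2, so besides a solution [a] only [1 - a] is possible. *)
apply: (@sub_countable _ _ _ [set a; 1 - a]).
  apply: subset_card_le => u /=; rewrite inE /= => xu.
  (* Here [r != 0] matters: in a gap of length 0 every location gives the value 0. *)
  have x0 : 3 * x != 0 by apply: contra_neq r0 => x0; rewrite -xa !mulrA x0 !mul0r.
  have : 3 * x * ((u - a) * (1 - a - u)) = 0.
    by rewrite -(subrr r) -{1}xu -xa; ring.
  move/eqP; rewrite mulf_eq0 (negbTE x0)/= mulf_eq0 !subr_eq0.
  by move=> /orP[/eqP->|/eqP->]; [left|right].
exact: finite_set_countable.
Qed.

(* On a gap longer than 2 r, locations in [1/4, 3/4] give at least 9 r / 8. *)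
Lemma scaled_variance_tail_gt0 (r : R) : unbounded_gaps Q Y -> 0 < r ->
  (0 < P [set w | (r < scaled_variance 1 w)%R])%E.
Proof.
move=> unb r0; have [_ lawU _] := model.
pose A : set R := `]2 * r, +oo[%classic.
pose B : set R := `[1 / 4, 3 / 4]%classic.
have mA : measurable A by exact: measurable_itv.
have mB : measurable B by exact: measurable_itv.
have mZ : measurable [set w | (r < scaled_variance 1 w)%R].
  exact/measurable_superlevel/measurable_scaled_variance.
have m1A : (0 < m1 A)%E.
  rewrite m1E//.
  have mYA : measurable [set s | 2 * r < Y s].
    exact: measurable_superlevel.
  (* Markov-type bound: on Y > 2 r the length-biasing weight exceeds 2 r. *)
  apply: (@lt_le_trans _ _ ((2 * r)%:E * Q [set s | (2 * r < Y s)%R])%E).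
    by rewrite mule_gt0// lte_fin mulr_gt0.
  rewrite -[X in Q X]setIT -integral_indic// -ge0_integralZl//; last 2 first.
    exact/measurable_EFinP.
    by rewrite lee_fin mulr_ge0 ?ltW.
  apply: ge0_le_integral => //.
  - by move=> s _; rewrite -EFinM lee_fin !mulr_ge0// ltW.
  - by apply: emeasurable_funM => //; exact/measurable_EFinP.
  - apply/measurable_EFinP/measurable_funM; exact: measurableT_comp.
  move=> s _; rewrite -EFinM lee_fin !indicE.
  have -> : (Y s \in A) = (s \in [set s | 2 * r < Y s]).
    by apply/idP/idP; rewrite !inE /A /= in_itv/= andbT.
  case: (boolP (s \in _)) => [|_]; last by rewrite mulr0 mul0r.
  by rewrite inE /= => h; rewrite mulr1 mul1r (le_trans (ltW h))// ler_norm.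
have m12 : (0 < m1 A * m2 B)%E.
  apply: mule_gt0 => //; rewrite -[X in (_ < X)%E]/(distribution P U B) lawU//.
  by apply: uniform_prob_itv_gt0; lra.
apply: (lt_le_trans m12).
rewrite -(gap_location_law 1)//; apply: le_measure; rewrite ?inE//.
  apply: measurableI; rewrite -[X in measurable X]setTI.
    exact: mXs.
  exact: measurable_funP.
move=> w; rewrite /A /B /= !in_itv/= andbT => -[h /andP[u1 u2]].
rewrite scaled_varianceE /scaled_bridge/=.
(* The product equals u (1 - u) - 3/16, and 3 * 2 r * 3/16 = 9 r / 8 > r. *)
have : (U w - 1 / 4) * (3 / 4 - U w) >= 0 by rewrite mulr_ge0 ?subr_ge0.
set x := 1 * Xs 1 w in h *; set u := U w => hu.
have x0 : 0 < x by lra.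
have : x * (u * (1 - u) - 3 / 16) >= 0 by rewrite mulr_ge0; lra.
lra.
Qed.

End scaled_variance.

(** * The cost of blindness as a function of R *)

Lemma hinge_slope_ge0 {R : realType} (t z : R) : 0 < t -> 0 <= hinge_slope t z.
Proof.
move=> t0; rewrite /hinge_slope; case: ifPn => // tz.
by rewrite -(pmulr_rge0 _ t0) ltW// (lt_trans _ tz).
Qed.

(** An instance of a_+ - a = (-a)_+. It turns calibrated minus blind utility into a mean hinge, and
    gives integrability of the calibrated integrand. *)
Lemma utility_hinge {R : realType} (z r : R) :
  Num.max (1 - z / r) 0 = hinge r^-1 z + (1 - z / r).
Proof. by rewrite /hinge /Num.max mulrC; case: ifPn; case: ifPn; lra. Qed.

Theorem proposition5 (R : realType)
    (dS : measure_display) (S : measurableType dS) (Q : probability S R)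
    (Y : {RV Q >-> R})
    (dT : measure_display) (T : measurableType dT) (P : probability T R)
    (Xs : R -> {RV P >-> R}) (U : {RV P >-> R})
    (Yshape : gap_shape Q Y) (model : task_model Q Y P Xs U) :
  exists UC DeltaB : R -> R,
    [/\ forall lambda q : R, 0 < lambda -> 0 < q ->
          [/\ calibrated_utility P (sigma2 (Xs lambda) U) q
                = (UC (3 * lambda * q))%:E,
              (calibrated_utility P (sigma2 (Xs lambda) U) q
                 - blind_utility P (sigma2 (Xs lambda) U) q)%E
                = (DeltaB (3 * lambda * q))%:E &
              ('E_P[fun w => Num.max (sigma2 (Xs lambda) U w / q - 1)%R 0%R])%E
                = (DeltaB (3 * lambda * q))%:E],
        forall lambda r : R, 0 < lambda -> 0 < r ->
          derivable DeltaB r 1 /\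
          (DeltaB^`()%classic r)%:E =
            ((- (1 / r ^+ 2))%:E *
             'E_P[fun w => (3 * lambda * sigma2 (Xs lambda) U w *
                \1_[set w' | r < 3 * lambda * sigma2 (Xs lambda) U w'] w)%R])%E &
        unbounded_gaps Q Y ->
          [/\ forall r : R, 0 < r -> 0 < DeltaB r,
              forall r s : R, 0 < r -> r < s -> DeltaB s < DeltaB r &
              forall r : R, 0 < r -> DeltaB^`()%classic r < 0]].
Proof.
pose Z := scaled_variance Xs U.
have mZ (lambda : R) : measurable_fun setT (Z lambda) by exact: measurable_scaled_variance.
have iZ (lambda : R) : 0 < lambda -> P.-integrable setT (EFin \o Z lambda).
  exact: integrable_scaled_variance _ _ Yshape model _.
have law (lambda : R) (f : R -> R) : 0 < lambda -> measurable_fun setT f -> (forall x, 0 <= f x) ->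
    (\int[P]_w (f (Z lambda w))%:E = \int[P]_w (f (Z 1 w))%:E)%E.
  exact: scaled_variance_law _ _ Yshape model _ _.
have iH (lambda t : R) : 0 < lambda -> P.-integrable setT (EFin \o (hinge t \o Z lambda)).
  by move=> l0; apply: integrable_hinge => //; exact: iZ.
have iB (lambda r : R) : 0 < lambda ->
    P.-integrable setT (EFin \o (fun w => 1 - Z lambda w / r)).
  move=> l0.
  have := integrableB measurableT (finite_measure_integrable_cst P 1 measurableT)
    (integrableZl measurableT r^-1 (iZ _ l0)).
  apply: eq_integrable => // w _ /=; by rewrite mulrC.
have iC (lambda r : R) : 0 < lambda ->
    P.-integrable setT (EFin \o (fun w => Num.max (1 - Z lambda w / r) 0)).
  move=> l0; apply: eq_integrable (integrableD measurableT (iH _ r^-1 l0) (iB _ r l0)) => //.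
  by move=> w _; rewrite /= utility_hinge.
(* Intensity 1 serves as representative; [law] carries the values to every [lambda]. *)
pose DeltaB (r : R) := mean_hinge P (Z 1) r^-1.
pose slope := mean_slope P (Z 1).
have slope_gt0 (r : R) : unbounded_gaps Q Y -> 0 < r -> 0 < slope r^-1.
  move=> unb r0; rewrite -lte_fin mean_slopeE//; last exact: iZ.
  have Pr := scaled_variance_tail_gt0 _ _ Yshape model r unb r0.
  (* E[Z 1{Z > r}] >= r P(Z > r). *)
  apply: (@lt_le_trans _ _ (r%:E * P [set w | (r < Z 1 w)%R])%E).
    by rewrite mule_gt0.
  have mE : measurable [set w | r < Z 1 w] by exact: measurable_superlevel.
  rewrite -[X in P X]setIT -integral_indic// -ge0_integralZl ?lee_fin ?(ltW r0)//; last first.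
    exact/measurable_EFinP.
  apply: ge0_le_integral => //.
  - by move=> w _; rewrite -EFinM lee_fin mulr_ge0// ltW.
  - by apply: emeasurable_funM => //; exact/measurable_EFinP.
  - by apply/measurable_EFinP/measurableT_comp => //; exact: measurable_hinge_slope.
  move=> w _; rewrite -EFinM lee_fin indicE.
  case: (boolP (w \in _)) => [|_]; rewrite ?mulr1 ?mulr0 ?hinge_slope_ge0 ?invr_gt0//.
  rewrite inE /= => h; rewrite /hinge_slope.
  by rewrite ltr_pdivlMl// mulr1 h ltW.
have dDelta (r : R) : 0 < r ->
    derivable DeltaB r 1 /\ DeltaB^`()%classic r = - (1 / r ^+ 2) * slope r^-1.
  move=> r0.
  (* The kink at t = 1 / r is the event Z = r, null because [r] is nonzero. *)
  have P0 : P [set w | r^-1 * Z 1 w = 1] = 0%E.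
    rewrite -[RHS](scaled_variance_atomless _ _ Yshape model r (lt0r_neq0 r0)).
    congr (P _); apply/seteqP; split => w /=; rewrite -/(Z 1 w).
      by move=> /(congr1 ( *%R r)); rewrite mulVKf ?gt_eqF// mulr1.
    by move=> ->; rewrite mulVf ?gt_eqF.
  have dh := is_derive_mean_hinge P (Z 1) (mZ 1) (iZ 1 ltr01) _ P0.
  have dV := @is_deriveV R id r 1 1 (lt0r_neq0 r0) (is_derive_id _ _).
  have [ih hE] := dh; have [iV VE] := dV.
  split; first by apply/derivable1_diffP/differentiable_comp; exact/derivable1_diffP.
  rewrite (derive1_comp iV ih) !derive1E hE VE.
  by rewrite /GRing.scale/= mulr1 mulrC div1r.
exists (fun r => \int[P]_w Num.max (1 - Z 1 w / r) 0), DeltaB; split.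
- move=> lambda q l0 q0; set r := 3 * lambda * q.
  have sE w : sigma2 (Xs lambda) U w / q = Z lambda w / r.
    rewrite /Z /scaled_variance /r; field; rewrite !gt_eqF//.
  have cE : calibrated_utility P (sigma2 (Xs lambda) U) q
      = (\int[P]_w (Num.max (1 - Z lambda w / r) 0)%:E)%E.
    by rewrite /calibrated_utility unlock; under eq_integral do rewrite sE.
  have hE : (\int[P]_w (hinge r^-1 (Z lambda w))%:E)%E = (DeltaB r)%:E.
    rewrite law//; [|exact: measurable_hinge|exact: hinge_ge0].
    by rewrite mean_hingeE//; exact: iZ.
  split.
  + rewrite cE (law lambda (fun z => Num.max (1 - z / r) 0))//.
    * by rewrite /Rintegral fineK// integrable_fin_num//; exact: iC.
    * apply: measurable_maxr => //; apply: measurable_funB => //.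
      exact: measurable_funM.
    * by move=> z; rewrite le_max lexx orbT.
  + rewrite cE /blind_utility unlock; under [X in (_ - X)%E]eq_integral do rewrite sE.
    (* Both integrands are integrable, so the extended-real difference is a single integral, whose
       integrand is the hinge. *)
    rewrite -integralB_EFin//; [|exact: iC|exact: iB].
    rewrite -hE; apply: eq_integral => w _.
    by rewrite utility_hinge -EFinB addrK.
  + rewrite unlock -hE; apply: eq_integral => w _; congr EFin.
    by rewrite sE /hinge mulrC.
- move=> lambda r l0 r0; have [dD dE] := dDelta r r0; split => //.
  rewrite dE EFinM; congr (_ * _)%E.
  rewrite unlock mean_slopeE//; last exact: iZ.
  (* Return from intensity 1 to [lambda]; [law] asks for a nonnegative function, which the slope is
     for t > 0. *)
  rewrite -(law lambda)//; last 2 first.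
  + exact: measurable_hinge_slope.
  + by move=> z; apply: hinge_slope_ge0; rewrite invr_gt0.
  apply: eq_integral => w _; congr EFin; rewrite /hinge_slope indicE.
  rewrite ltr_pdivlMl// mulr1 -/(Z lambda w).
  case: ifPn => h; first by rewrite mem_set ?mulr1.
  by rewrite memNset ?mulr0//= => h'; move: h; rewrite -/(Z lambda w) h'.
- move=> unb.
  have decr (r s : R) : 0 < r -> r < s -> DeltaB s < DeltaB r.
    move=> r0 rs; have s0 := lt_trans r0 rs.
    (* The subgradient at 1 / s, tested at 1 / r, gives DeltaB(r) - DeltaB(s) >= (1/r - 1/s)
       slope(1/s), a product of positive factors. *)
    have := mean_hinge_subgradient P (Z 1) (mZ 1) (iZ 1 ltr01) s^-1 r^-1.
    rewrite -subr_gt0; apply: lt_le_trans.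
    by rewrite mulr_gt0 ?slope_gt0// subr_gt0 ltf_pV2.
  have ge0 r : 0 <= DeltaB r.
    by apply: Rintegral_ge0 => w _; exact: hinge_ge0.
  split => //.
  (* DeltaB(r) > DeltaB(r + 1) >= 0. *)
  + move=> r r0; apply: le_lt_trans (decr r (r + 1) r0 _) => //; first by rewrite ltrDl.
  + move=> r r0; have [_ dE] := dDelta r r0; rewrite dE.
    by rewrite mulNr oppr_lt0 mulr_gt0 ?slope_gt0// divr_gt0// exprn_gt0.
Qed.
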